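(* Let $F$ be a set functor with $F1\neq\emptyset$, equipped with a uniform encoding $\flat_X\colon FX\to\mathcal{B}(A\times X)$ and a minimization interface $\mathtt{merge}$. Let $(X,c)$ be a finite $F$-coalgebra and $q\colon(X,c)\twoheadrightarrow(Y,d)$ a surjective $F$-coalgebra morphism. Define $e\colon Y\to\mathcal{B}(A\times Y)$ by choosing, for each $y\in Y$, some $x\in X$ with $q(x)=y$ and setting $e(y)=(\mathrm{ungroup}\circ\mathtt{merge}^{(Y)}\circ\mathrm{group}\circ\mathcal{B}(A\times q)\circ\flat_X\circ c)(x)$, i.e. $e(y)(a,y')=\mathtt{merge}(b_{x,y'})(a)$ where $b_{x,y'}(a')=\mathcal{B}(A\times q)(\flat_X(c(x)))(a',y')$. Then $e$ does not depend on the choice of $x$ and $e=\flat_Y\circ d$. Moreover, if $\mathtt{merge}$ runs in linear time in (the size of) its input, then $e$ can be computed from $\flat_X\circ c$ (given as adjacency lists) and the partition of $X$ associated to $q$ in time linear in the size $|X|+\sum_{x\in X}|\flat_X(c(x))|$ of the input coalgebra $\flat_X\circ c$.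
   Context: An $F$-coalgebra is a set $X$ with a map $c\colon X\to FX$; a morphism $h\colon(X,c)\to(Y,d)$ is a map with $Fh\circ c=d\circ h$. $\mathcal{B}$ is the bag functor ($\mathcal{B}X$ = finitely supported maps $X\to\mathbb{N}$; $\mathcal{B}f(b)(y)=\sum_{f(x)=y}b(x)$; $|b|$ is the number of elements of the bag counted with multiplicity). For $S\subseteq X$, $\mathrm{fil}_S\colon\mathcal{B}(A\times X)\to\mathcal{B}(A)$, $\mathrm{fil}_S(b)(a)=\sum_{x\in S}b(a,x)$. $2=\{0,1\}$, $\chi_S$ the characteristic map. An encoding of $F$ is a label set $A$ with maps $\flat_X\colon FX\to\mathcal{B}(A\times X)$ such that $\langle F!,\flat_X\rangle\colon FX\to F1\times\mathcal{B}(A\times X)$ is injective for each $X$; it is uniform if $\mathrm{fil}_{\{x\}}\circ\flat_X=\mathrm{fil}_{\{1\}}\circ\flat_2\circ F\chi_{\{x\}}$ for all $X$, $x\in X$. A minimization interface is $\mathtt{merge}\colon\mathcal{B}(A)\to\mathcal{B}(A)$ with $\mathtt{merge}\circ\mathrm{fil}_S\circ\flat_X=\mathrm{fil}_{\{1\}}\circ\flat_2\circ F\chi_S$ for all $X$, $S\subseteq X$. $\mathcal{B}(A)^{(Y)}$ = maps $g\colon Y\to\mathcal{B}(A)$ that are the empty bag at all but finitely many points; $\mathrm{group}(b)(y)(a)=b(a,y)$, $\mathrm{ungroup}(g)(a,y)=g(y)(a)$, $\mathtt{merge}^{(Y)}(g)=\mathtt{merge}\circ g$. *)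

(* Defs.v *)
From mathcomp Require Import all_boot finmap multiset.
From mathcomp Require Import mathcomp_extra boolp classical_sets functions.
From mathcomp Require Import cardinality fsbigop.

Set Implicit Arguments.
Unset Strict Implicit.
Unset Printing Implicit Defensive.

Local Open Scope classical_set_scope.
Local Open Scope nat_scope.

Record set_functor := SetFunctor {
  fobj :> Type -> Type;
  fmap : forall X Y : Type, (X -> Y) -> fobj X -> fobj Y;
  fmap_id : forall (X : Type) (t : fobj X), fmap id t = t;
  fmap_comp : forall (X Y Z : Type) (g : Y -> Z) (f : X -> Y) (t : fobj X),
    fmap (g \o f) t = fmap g (fmap f t) }.
Arguments fmap F {X Y} : rename.

Definition coalg_morphism (F : set_functor) (X Y : Type)
    (c : X -> F X) (d : Y -> F Y) (h : X -> Y) : Prop :=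
  fmap F h \o c = d \o h.

(* Finite multisets over an arbitrary type; the function coercion of [{mset _}]
   makes [b x] the multiplicity of [x] in [b]. *)
Definition bag (X : Type) := ({mset {classic X}})%mset.

(* [enum_mset b] lists the elements of [b] with their multiplicities. *)
Definition bag_size (X : Type) (b : bag X) : nat := size (enum_mset b).

Definition empty_bag (X : Type) : bag X := mset0.

(* The bag with given multiplicities. A function whose support is infinite is
   not a bag and is sent to the empty bag; [bagmapE], [filE], [groupE] and
   [ungroupE] show that this case does not arise below. *)
Definition finbag (X : Type) (f : X -> nat) : bag X :=
  [fsfun x in fset_set [set x : {classic X} | f x != 0] => f x].

Definition bagmap (X Y : Type) (f : X -> Y) (b : bag X) : bag Y :=
  finbag (fun y => \big[addn/0]_(x \in [set x : {classic X} | f x = y]) b x).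

Definition fil (A X : Type) (S : set X) (b : bag (A * X)) : bag A :=
  finbag (fun a => \big[addn/0]_(x \in (S : set {classic X})) b (a, x)).

Definition group (A Y : Type) (b : bag (A * Y)) (y : Y) : bag A :=
  finbag (fun a => b (a, y)).

Definition ungroup (A Y : Type) (g : Y -> bag A) : bag (A * Y) :=
  finbag (fun p => g p.2 p.1).

Lemma finbagE (X : Type) (f : X -> nat) :
  finite_set [set x | f x != 0] -> finbag f =1 f.
Proof.
move=> fin x; rewrite /finbag fsfunE (@in_fset_set {classic X} _ fin).
case: ifPn => //; rewrite notin_setE /= => /negP.
by rewrite negbK => /eqP.
Qed.

Lemma finite_bag (X : Type) (b : bag X) : finite_set [set x | b x != 0].
Proof.
apply: (@sub_finite_set {classic X} _ [set` finsupp b]) => [x /=|].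
  by rewrite mem_finsupp.
exact: finite_fset.
Qed.

Lemma fsbig_neq0 (X : choiceType) (S : set X) (f : X -> nat) :
  \big[addn/0]_(x \in S) f x != 0 -> exists2 x, S x & f x != 0.
Proof.
apply: contraPP => none /eqP; apply; apply: fsbig1 => x Sx.
by apply: contra_notP none => /eqP fx; exists x.
Qed.

Lemma bagmapE (X Y : Type) (f : X -> Y) (b : bag X) (y : Y) :
  bagmap f b y = \big[addn/0]_(x \in [set x : {classic X} | f x = y]) b x.
Proof.
rewrite /bagmap finbagE //.
apply: sub_finite_set (finite_image f (finite_bag b)) => z /=.
by move=> /fsbig_neq0[x /= fx bx]; exists x.
Qed.

Lemma filE (A X : Type) (S : set X) (b : bag (A * X)) (a : A) :
  fil S b a = \big[addn/0]_(x \in (S : set {classic X})) b (a, x).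
Proof.
rewrite /fil finbagE //.
apply: sub_finite_set (finite_image fst (finite_bag b)) => z /=.
by move=> /fsbig_neq0[x /= Sx bx]; exists (z, x).
Qed.

Lemma groupE (A Y : Type) (b : bag (A * Y)) (y : Y) (a : A) :
  group b y a = b (a, y).
Proof.
rewrite /group finbagE //.
apply: sub_finite_set (finite_image fst (finite_bag b)) => z /= bz.
by exists (z, y).
Qed.

Lemma ungroupE (A Y : Type) (g : Y -> bag A) (a : A) (y : Y) :
  finite_set [set y' | g y' <> empty_bag A] -> ungroup g (a, y) = g y a.
Proof.
move=> fin; rewrite /ungroup finbagE //=.
have fU : finite_set (\bigcup_(y' in [set y' | g y' <> empty_bag A])
    ((fun a' => (a', y')) @` [set a' | g y' a' != 0])).
  by apply: bigcup_finite => // y' _; apply: finite_image; exact: finite_bag.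
apply: sub_finite_set fU => -[a' y'] /= ga.
exists y'; last by exists a'.
by move=> /= ge; move: ga; rewrite ge fsfunE.
Qed.

(* [bool] is the two-element set, [true] its element 1; [unit] is the
   one-element set. *)
Definition chi (X : Type) (S : set X) (x : X) : bool := `[< S x >].

Definition is_encoding (F : set_functor) (A : Type)
    (flat : forall X : Type, F X -> bag (A * X)) : Prop :=
  forall X : Type,
    injective (fun t : F X => (fmap F (fun=> tt) t, flat X t)).

Definition uniform (F : set_functor) (A : Type)
    (flat : forall X : Type, F X -> bag (A * X)) : Prop :=
  forall (X : Type) (x : X),
    fil [set x] \o flat X =
    fil [set true] \o flat bool \o fmap F (chi [set x]).

Definition minimization_interface (F : set_functor) (A : Type)
    (flat : forall X : Type, F X -> bag (A * X))
    (merge : bag A -> bag A) : Prop :=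
  forall (X : Type) (S : set X),
    merge \o fil S \o flat X =
    fil [set true] \o flat bool \o fmap F (chi S).

(* [grouped_edges flat c q x y'] is the bag of labels of the edges from [x] into
   the fibre of [y'] under [q]. *)
Definition grouped_edges (F : set_functor) (A : Type)
    (flat : forall X : Type, F X -> bag (A * X)) (X Y : Type)
    (c : X -> F X) (q : X -> Y) (x : X) : Y -> bag A :=
  group (bagmap (fun p : A * X => (p.1, q p.2)) (flat X (c x))).

(* Finitely supported maps [Y -> bag A] are taken among all maps, so that the
   pointwise extension of [merge] to them is composition. It preserves finite
   support if [merge] fixes the empty bag, which holds for the minimization
   interfaces of uniform encodings of functors with [F unit] inhabited. *)
Definition merged_edges (F : set_functor) (A : Type)
    (flat : forall X : Type, F X -> bag (A * X)) (merge : bag A -> bag A)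
    (X Y : Type) (c : X -> F X) (q : X -> Y) (x : X) : bag (A * Y) :=
  ungroup (merge \o grouped_edges flat c q x).

(* A unit-cost random access machine, programmed with structured control flow.
   It has registers and arrays, finitely many of which occur in any given
   program; a cell holds a natural number or a label. Labels can be moved
   around, but are opaque except to the operations of the interpretation
   [ops], each of which also costs one step: these are whatever elementary
   operations (comparison, addition, ...) the label set comes with. *)
Inductive value (A : Type) := Num of nat | Lab of A.
Arguments Num {A}.

Inductive program :=
  | Skip
  | Const of nat & nat                (* register := number *)
  | Move of nat & nat                 (* register := register *)
  | Add of nat & nat & nat
  | Sub of nat & nat & nat            (* truncated at 0 *)
  | Prim of nat & nat & seq nat       (* register := operation (registers) *)
  | Fetch of nat & nat & nat          (* register := array [register] *)
  | Store of nat & nat & nat          (* array [register] := register *)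
  | Seq of program & program
  | If of nat & program & program     (* tests register != 0 *)
  | While of nat & program.

Record state (A : Type) := State {
  reg : nat -> value A;
  mem : nat -> nat -> value A }.

Section Machine.
Variables (A : Type) (ops : nat -> seq (value A) -> value A).
Implicit Types st : state A.

Definition num (v : value A) : nat := if v is Num n then n else 0.

Definition set_reg st (r : nat) (v : value A) : state A :=
  State (fun r' => if r' == r then v else reg st r') (mem st).

Definition set_mem st (a i : nat) (v : value A) : state A :=
  State (reg st) (fun a' i' =>
    if (a' == a) && (i' == i) then v else mem st a' i').

(* [exec p st st' t]: from [st], [p] halts in [st'] after [t] steps. *)
Inductive exec : program -> state A -> state A -> nat -> Prop :=
  | exec_skip st : exec Skip st st 1
  | exec_const r n st : exec (Const r n) st (set_reg st r (Num n)) 1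
  | exec_move r s st : exec (Move r s) st (set_reg st r (reg st s)) 1
  | exec_add r s u st : exec (Add r s u) st
      (set_reg st r (Num (num (reg st s) + num (reg st u)))) 1
  | exec_sub r s u st : exec (Sub r s u) st
      (set_reg st r (Num (num (reg st s) - num (reg st u)))) 1
  | exec_prim r f rs st : exec (Prim r f rs) st
      (set_reg st r (ops f (map (reg st) rs))) 1
  | exec_fetch r a i st : exec (Fetch r a i) st
      (set_reg st r (mem st a (num (reg st i)))) 1
  | exec_store a i r st : exec (Store a i r) st
      (set_mem st a (num (reg st i)) (reg st r)) 1
  | exec_seq p1 p2 st st1 st2 t1 t2 :
      exec p1 st st1 t1 -> exec p2 st1 st2 t2 ->
      exec (Seq p1 p2) st st2 (t1 + t2)
  | exec_if r p1 p2 st st' t :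
      exec (if num (reg st r) != 0 then p1 else p2) st st' t ->
      exec (If r p1 p2) st st' t.+1
  | exec_while_stop r p st :
      num (reg st r) = 0 -> exec (While r p) st st 1
  | exec_while_step r p st st1 st2 t1 t2 :
      num (reg st r) != 0 ->
      exec p st st1 t1 -> exec (While r p) st1 st2 t2 ->
      exec (While r p) st st2 (t1 + t2).+1.

Definition halts_within (p : program) st (t : nat) (post : state A -> Prop) : Prop :=
  exists st' t', [/\ exec p st st' t', t' <= t & post st'].

(* Cells of the array past the end of [vs] are arbitrary. *)
Definition array_holds st (a : nat) (vs : seq (value A)) : Prop :=
  forall i, i < size vs -> mem st a i = nth (Num 0) vs i.

(* A bag of labels is listed, in any order, in array 0, its length in
   register 0. *)
Definition bag_at (b : bag A) st : Prop :=
  exists s : seq {classic A},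
    [/\ seq_mset s = b, reg st 0 = Num (size s)
      & array_holds st 0 (map (@Lab A) s)].

(* Adjacency lists of [e], for the numbering [nu] of [Z]: [l i] lists the edges
   of node [i] in any order, and all lists are stored one after the other, their
   labels in array 1 and their targets in array 2. Array 0 contains the [n.+1]
   boundaries between the lists, register 0 the number of nodes. *)
Definition adjacency_at (n : nat) (Z : Type) (nu : 'I_n -> Z)
    (e : Z -> bag (A * Z)) st : Prop :=
  exists l : 'I_n -> seq (A * 'I_n),
    let lists := [seq l i | i <- enum 'I_n] in
    [/\ forall i,
          seq_mset ([seq (p.1, nu p.2) | p <- l i] : seq {classic A * Z})
            = e (nu i),
        reg st 0 = Num n,
        array_holds st 0
          [seq Num (sumn (take k (shape lists))) | k <- iota 0 n.+1],
        array_holds st 1 [seq Lab p.1 | p <- flatten lists]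
      & array_holds st 2 [seq Num (nat_of_ord p.2) | p <- flatten lists]].

(* The partition of [X] into the fibres of [q], as an array of block numbers
   (array 3), with the number of blocks in register 1; the block [i] is the
   fibre of [rho i]. *)
Definition partition_at (n m : nat) (X Y : Type) (nu : 'I_n -> X)
    (rho : 'I_m -> Y) (q : X -> Y) st : Prop :=
  exists beta : 'I_n -> 'I_m,
    [/\ forall i, rho (beta i) = q (nu i),
        reg st 1 = Num m
      & array_holds st 3 [seq Num (nat_of_ord (beta i)) | i <- enum 'I_n]].

(* Registers and arrays other than those holding the input are not initialised:
   a program has to work whatever they contain. The bound is affine because
   the empty bag also takes time. *)
Definition merge_linear_time (merge : bag A -> bag A) : Prop :=
  exists (p : program) (k : nat), forall (b : bag A) st,
    bag_at b st ->
    halts_within p st (k * (bag_size b).+1) (bag_at (merge b)).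

End Machine.

(* Main.v *)
(* Since [chi (q^-1 y) = chi {y} o q] and [q] is a morphism, the interface axiom
   for [q^-1 y] and uniformity at [y] show that merging the labels of the edges
   from [x] into the fibre of [y] yields the labels of the edges from [q x] to
   [y] in [flat Y o d]; hence [e = flat Y o d], whatever representatives are
   chosen.

   For the running time, the edges of one representative of each block are
   distributed over linked lists, one for each target block. A second pass over
   the same edges empties the lists, passing each nonempty one to [merge], and
   resets their heads, so that no time is spent on blocks that are not targets.
   The edges of the representatives are at most those of the whole coalgebra,
   and the output of [merge] is linear in its input because writing it takes
   time. *)

Require Import Defs.
From mathcomp Require Import all_boot finmap multiset.
From mathcomp Require Import mathcomp_extra boolp classical_sets functions.
From mathcomp Require Import cardinality fsbigop.
From mathcomp Require Import zify.
(* [Num] and [Sub] are also mathcomp names. *)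
Import Defs.

Set Implicit Arguments.
Unset Strict Implicit.
Unset Printing Implicit Defensive.

(** * Merged edges and the encoding of the quotient coalgebra *)

Lemma bag_ext (X : Type) (b b' : bag X) : b =1 b' -> b = b'.
Proof. by move/msetP. Qed.

Lemma fil1E (A X : Type) (x : X) (b : bag (A * X)) (a : A) :
  fil [set x] b a = b (a, x).
Proof. by rewrite filE (@fsbig_set1 _ _ _ {classic X}). Qed.

(** The pairs sent to [(a, y)] are the [(a, x)] with [x] in the fibre of [y]. This brings grouped
    edges into the form that the interface axiom speaks about. *)
Lemma group_bagmapE (A X Y : Type) (q : X -> Y) (b : bag (A * X)) (y : Y) :
  group (bagmap (fun p : A * X => (p.1, q p.2)) b) y = fil [set x | q x = y] b.
Proof.
apply: bag_ext => a; rewrite groupE bagmapE filE.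
rewrite (reindex_fsbig (fun x : {classic X} => (a, x) : {classic A * X})
  [set x : {classic X} | q x = y]) //.
split=> [x /= <- //|x z _ _ [] //|[a' x] /= [-> <-]].
by exists x.
Qed.

Section MergedEdges.
Variables (F : set_functor) (A : Type).
Variables (flat : forall X : Type, F X -> bag (A * X)) (merge : bag A -> bag A).
Hypothesis flat_uniform : uniform flat.
Hypothesis merge_interface : minimization_interface flat merge.

Lemma merge_grouped_edges (X Y : Type) (c : X -> F X) (d : Y -> F Y)
    (q : X -> Y) (x : X) (y : Y) :
  coalg_morphism c d q ->
  merge (grouped_edges flat c q x y) = fil [set y] (flat (d (q x))).
Proof.
move=> hq; rewrite /grouped_edges group_bagmapE.
have /= -> := congr1 (fun f => f (c x)) (merge_interface [set z | q z = y]%classic).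
have /= -> := congr1 (fun f => f (d (q x))) (flat_uniform y).
have /= <- := congr1 (fun f => f x) hq.
(* The remaining identity, [chi [set y] \o q] against the characteristic map of the fibre, holds by
   conversion. *)
by rewrite -fmap_comp.
Qed.

Lemma merged_edgesE (X Y : Type) (c : X -> F X) (d : Y -> F Y)
    (q : X -> Y) (x : X) :
  coalg_morphism c d q ->
  (forall a y, merged_edges flat merge c q x (a, y) =
     merge (grouped_edges flat c q x y) a) /\
  merged_edges flat merge c q x = flat (d (q x)).
Proof.
move=> hq.
have E a y : merged_edges flat merge c q x (a, y) =
             merge (grouped_edges flat c q x y) a.
  rewrite /merged_edges ungroupE //=.
  (* [ungroup] is faithful only on finitely supported maps. The merged bags are those of
     [flat (d (q x))], so they are empty away from the finitely many targets occurring there. *)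
  apply: sub_finite_set (finite_image snd (finite_bag (flat (d (q x))))).
  move=> y' /= ne; apply: contra_notP ne => no.
  apply: bag_ext => a'; rewrite (merge_grouped_edges _ _ hq) fil1E fsfunE /=.
  by apply/eqP; apply: contra_notT no => nz; exists (a', y').
split=> //; apply: bag_ext => -[a y].
by rewrite E (merge_grouped_edges _ _ hq) fil1E.
Qed.

(* With [t : F nat] the image of an element of [F unit] under the point [0],
   uniformity makes the labels of [flat t] at every [x <> 0] the same bag, namely
   [merge mset0]; as [flat t] is finite, that bag is empty. *)
Lemma merge_empty : inhabited (F unit) -> merge (empty_bag A) = empty_bag A.
Proof.
move=> [t0].
pose t : F nat := fmap F (fun=> 0) t0.
have E (x : nat) : merge (empty_bag A) = fil [set x.+1] (flat t).
  have /= -> := congr1 (fun f => f t) (flat_uniform x.+1).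
  have -> : empty_bag A = fil set0 (flat t).
    by apply: bag_ext => a; rewrite filE fsbig_set0 fsfunE.
  have /= -> := congr1 (fun f => f t) (merge_interface (set0 : set nat)).
  have tE (g : nat -> bool) : fmap F g t = fmap F (g \o fun=> 0) t0.
    by rewrite fmap_comp.
  rewrite (tE (chi set0)).
  rewrite (tE (chi [set x.+1]%classic)).
  have -> // : chi set0 \o (fun=> 0) =
      chi [set x.+1]%classic \o (fun=> 0) :> (unit -> bool).
  by apply: funext => u /=; apply/asboolP/asboolP.
apply: bag_ext => a; rewrite [RHS]fsfunE /=; apply: contrapT => nz.
apply: infinite_nat.
have fin := finite_bag (flat t).
apply: sub_finite_set (finite_preimage (f := fun x => (a, x.+1)) _ fin).
  by move=> x _ /=; apply/eqP; rewrite -fil1E -E.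
by move=> x y _ _ [].
Qed.

End MergedEdges.

(* Write footprints and relocation of programs *)
Declare Scope program_scope.
Delimit Scope program_scope with prog.
Notation "p ;; q" := (Seq p q) (at level 60, right associativity) : program_scope.
Local Open Scope program_scope.

Fixpoint writes_reg (p : program) (r : nat) : bool :=
  match p with
  | Const r' _ | Move r' _ | Add r' _ _ | Sub r' _ _ | Prim r' _ _
  | Fetch r' _ _ => r == r'
  | Skip | Store _ _ _ => false
  | Seq p1 p2 | If _ p1 p2 => writes_reg p1 r || writes_reg p2 r
  | While _ p1 => writes_reg p1 r
  end.

Fixpoint writes_mem (p : program) (a : nat) : bool :=
  match p with
  | Store a' _ _ => a == a'
  | Seq p1 p2 | If _ p1 p2 => writes_mem p1 a || writes_mem p2 a
  | While _ p1 => writes_mem p1 a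
  | _ => false
  end.

(** Relocation lets the unknown program for [merge] run as a subroutine: all its registers and
    arrays lie at [k] or above, out of reach of those of the caller below [k]. *)
Fixpoint shift (k : nat) (p : program) : program :=
  match p with
  | Skip => Skip
  | Const r n => Const (k + r) n
  | Move r s => Move (k + r) (k + s)
  | Add r s u => Add (k + r) (k + s) (k + u)
  | Sub r s u => Sub (k + r) (k + s) (k + u)
  | Prim r f rs => Prim (k + r) f (map (addn k) rs)
  | Fetch r a i => Fetch (k + r) (k + a) (k + i)
  | Store a i r => Store (k + a) (k + i) (k + r)
  | Seq p1 p2 => Seq (shift k p1) (shift k p2)
  | If r p1 p2 => If (k + r) (shift k p1) (shift k p2)
  | While r p1 => While (k + r) (shift k p1)
  end.

Lemma writes_reg_shift k p r : r < k -> writes_reg (shift k p) r = false.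
Proof.
move=> rk.
elim: p => //= [r' _|r' _|r' _ _|r' _ _|r' _ _|r' _ _|p -> q ->|_ p -> q ->] //;
  by apply/negbTE; lia.
Qed.

Lemma writes_mem_shift k p a : a < k -> writes_mem (shift k p) a = false.
Proof.
move=> ak; elim: p => //= [a' _ _|p -> q -> //|_ p -> q -> //].
by apply/negbTE; lia.
Qed.

(** * Program logic with running times *)

Section Logic.
Variables (A : Type) (ops : nat -> seq (value A) -> value A).
Implicit Types (st : state A) (p : program).

(** A functional form of single commands, so that straight-line code is executed by simplification.
    [Prim] is left out because it occurs only inside the given program for [merge]. *)
Definition step p st : option (state A) :=
  match p with
  | Skip => Some st
  | Const r n => Some (set_reg st r (Num n))
  | Move r s => Some (set_reg st r (reg st s))
  | Add r s u => Some (set_reg st r (Num (num (reg st s) + num (reg st u))))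
  | Sub r s u => Some (set_reg st r (Num (num (reg st s) - num (reg st u))))
  | Fetch r a i => Some (set_reg st r (mem st a (num (reg st i))))
  | Store a i r => Some (set_mem st a (num (reg st i)) (reg st r))
  | _ => None
  end.

Lemma exec_step p st st' : step p st = Some st' -> exec ops p st st' 1.
Proof.
by case: p => //= *; match goal with H : Some _ = _ |- _ => case: H => <- end;
  constructor.
Qed.

(** What a run leaves alone can be read off the syntax. The rules below hand this fact on, so that
    invariants need not list unchanged cells. *)
Definition frame p st st' : Prop :=
  (forall r, ~~ writes_reg p r -> reg st' r = reg st r) /\
  (forall a, ~~ writes_mem p a -> mem st' a = mem st a).

Lemma frame_trans p st1 st2 st3 :
  frame p st1 st2 -> frame p st2 st3 -> frame p st1 st3.
Proof.
by move=> [r1 m1] [r2 m2]; split=> ? w; [rewrite r2 ?r1|rewrite m2 ?m1].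
Qed.

Lemma exec_frame p st st' t : exec ops p st st' t -> frame p st st'.
Proof.
elim=> {p st st' t} /=; try by move=> *; split=> //= r' /negbTE->.
- move=> p1 p2 st st1 st2 t1 t2 _ [r1 m1] _ [r2 m2].
  by split=> ? /norP[? ?]; [rewrite r2 ?r1|rewrite m2 ?m1].
- move=> r p1 p2 st st' t _.
  by case: ifP => _ [r1 m1]; split=> ? /norP[? ?];
    [exact: r1|exact: m1|exact: r1|exact: m1].
- move=> r p st st1 st2 t1 t2 _ _ f1 _ f2.
  exact: frame_trans f1 f2.
Qed.

Local Notation runs := (halts_within ops).

Lemma runs_weaken p st t t' (Q Q' : state A -> Prop) :
  t <= t' -> (forall st', Q st' -> frame p st st' -> Q' st') ->
  runs p st t Q -> runs p st t' Q'.
Proof.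
move=> tt QQ [st' [u [e ut q]]]; exists st', u; split=> //.
  exact: leq_trans tt.
by apply: QQ => //; apply: exec_frame e.
Qed.

Lemma runs_leq p st t t' (Q : state A -> Prop) :
  t <= t' -> runs p st t Q -> runs p st t' Q.
Proof. by move=> tt; apply: runs_weaken. Qed.

Lemma runs_step p st st' t (Q : state A -> Prop) :
  step p st = Some st' -> 0 < t -> Q st' -> runs p st t Q.
Proof. by move=> s t0 q; exists st', 1; split=> //; apply: exec_step. Qed.

Lemma runs_step_seq p1 p2 st st1 t (Q : state A -> Prop) :
  step p1 st = Some st1 -> 0 < t -> runs p2 st1 t.-1 Q -> runs (p1 ;; p2) st t Q.
Proof.
move=> s t0 [st' [u [e ut q]]]; exists st', (1 + u); split=> //; last by lia.
by apply: exec_seq e; apply: exec_step.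
Qed.

Lemma runs_seq p1 p2 st t1 t2 (Q1 Q : state A -> Prop) :
  runs p1 st t1 Q1 ->
  (forall st1, Q1 st1 -> frame p1 st st1 -> runs p2 st1 t2 Q) ->
  runs (p1 ;; p2) st (t1 + t2) Q.
Proof.
move=> [st1 [u1 [e1 ut1 q1]]] /(_ _ q1 (exec_frame e1)) [st2 [u2 [e2 ut2 q2]]].
by exists st2, (u1 + u2); split=> //; [apply: exec_seq e1 e2|apply: leq_add].
Qed.

Lemma runs_if r p1 p2 st t (Q : state A -> Prop) :
  runs (if num (reg st r) != 0 then p1 else p2) st t Q ->
  runs (If r p1 p2) st t.+1 Q.
Proof. by move=> [st' [u [e ut q]]]; exists st', u.+1; split=> //; constructor. Qed.

(** Amortised loop rule: [pot k] bounds the steps spent from iteration [k] on. The strict inequality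
    pays for the test before each iteration, the successor in the conclusion for the last, failing
    test. *)
Lemma runs_while r p st (N : nat) (Inv : nat -> state A -> Prop) (pot : nat -> nat) :
  Inv 0 st ->
  (forall st', frame p st st' -> Inv N st' -> num (reg st' r) = 0) ->
  (forall k st', k < N -> frame p st st' -> Inv k st' ->
     num (reg st' r) != 0 /\
     exists2 t, t + pot k.+1 < pot k & runs p st' t (Inv k.+1)) ->
  runs (While r p) st (pot 0).+1 (Inv N).
Proof.
move=> I0 stop iter.
suff H j k st' : k + j = N -> frame p st st' -> Inv k st' ->
    runs (While r p) st' (pot k).+1 (Inv N).
  by apply: (H N 0).
elim: j k st' => [|j IHj] k st' kj fr Ik.
  exists st', 1; split=> //; last by have <- : k = N by lia.
  by apply: exec_while_stop; apply: stop fr _; have <- : k = N by lia.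
have [|nz [t tk [st1 [t1 [e1 le1 I1]]]]] := iter k st' _ fr Ik; first by lia.
have fr1 := frame_trans fr (exec_frame e1).
have [|st2 [t2 [e2 le2 I2]]] := IHj k.+1 st1 _ fr1 I1; first by lia.
exists st2, (t1 + t2).+1; split=> //; last by lia.
exact: exec_while_step e1 e2.
Qed.

(* [for_to i b p] runs [p] for [i] from its current value up to the bound in
   register [b], excluded; register 2 has to hold the number 1, and register 4
   is the guard of the loop. *)
Definition for_to (i b : nat) (p : program) : program :=
  Sub 4 b i ;; While 4 (p ;; Add i i 2 ;; Sub 4 b i).

Lemma writes_reg_for i b p r :
  writes_reg (for_to i b p) r = [|| r == 4, r == i | writes_reg p r].
Proof. by rewrite /=; case: eqP; case: eqP; case: writes_reg. Qed.

Lemma writes_mem_for i b p a : writes_mem (for_to i b p) a = writes_mem p a.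
Proof. exact: orbF. Qed.

(** The [2] in the potential pays for incrementing [i] and recomputing the guard; the two extra
    steps at the end are the initial guard and the failing test. Since the loop itself writes [i]
    and register 4, the invariant must be insensitive to both. *)
Lemma runs_for i b p st lo N (Inv : nat -> state A -> Prop) (pot : nat -> nat) :
  i \notin [:: b; 2; 4] -> b \notin [:: 2; 4] ->
  ~~ writes_reg p i -> ~~ writes_reg p b -> ~~ writes_reg p 2 ->
  reg st 2 = Num 1 -> reg st i = Num lo -> reg st b = Num (lo + N) ->
  (forall k st' v w, Inv k st' -> Inv k (set_reg (set_reg st' i v) 4 w)) ->
  Inv 0 st ->
  (forall k st', k < N -> frame (for_to i b p) st st' -> reg st' i = Num (lo + k) ->
     Inv k st' -> exists2 t, t + 2 + pot k.+1 < pot k & runs p st' t (Inv k.+1)) ->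
  runs (for_to i b p) st (pot 0).+2
    (fun st' => Inv N st' /\ reg st' i = Num (lo + N)).
Proof.
rewrite !inE !negb_or => /and3P[ib i2 i4] /andP[b2 b4].
move=> wi wb w2 one regi regb stable I0 body.
apply: runs_step_seq => //=.
pose J k st' := Inv k st' /\
  [/\ reg st' i = Num (lo + k), reg st' b = Num (lo + N),
      reg st' 2 = Num 1 & reg st' 4 = Num (N - k)].
have i2' : (2 == i) = false by rewrite eq_sym; apply/negbTE.
have bi' : (b == i) = false by rewrite eq_sym; apply/negbTE.
apply: (@runs_weaken _ _ (pot 0).+1 _ (J N)); first by [].
  by move=> st' [IN []].
apply: runs_while.
- split=> /=.
    (* Only the guard has been set; writing the old value back to [i] gives the shape covered by
       [stable]. *)
    rewrite (_ : set_reg _ 4 _ = set_reg (set_reg st i (reg st i)) 4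
       (Num (num (reg st b) - num (reg st i)))).
      exact: stable.
    rewrite /set_reg; congr State; apply: funext => r /=.
    by case: ifP => // _; case: eqP => // ->.
  rewrite (negbTE i4) (negbTE b4) regi regb addn0; split=> //=.
  by rewrite subn0 addKn.
- by move=> st' _ [_ [_ _ _ ->]] /=; rewrite subnn.
move=> k st' kN [frr frm] [Ik [ri rb r2 r4]]; split.
  by rewrite r4 /= -lt0n subn_gt0.
have fr : frame (for_to i b p) st st'.
  by split=> [r /norP[w4 w]|a w]; [rewrite frr //= ifN|rewrite frm].
have [t tpot runp] := body k st' kN fr ri Ik.
exists (t + 2); first by [].
apply: runs_seq runp _ => st1 I1 [f1 _].
apply: runs_step_seq => //=.
apply: runs_step => //=.
rewrite /J /= eqxx (negbTE i4) (negbTE b4) i2' bi' (f1 i) // (f1 2) // (f1 b) //.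
rewrite ri rb r2 /=; split; first exact: stable.
by split=> //; congr Num; lia.
Qed.

(** A lockstep simulation: [lift u] keeps the cells of [st] below [k] and places [u] above them, and
    reads and writes commute with [lift]. *)
Lemma exec_shift k p s s' t (st : state A) :
  exec ops p s s' t ->
  let lift (u : state A) := State
    (fun r => if r < k then reg st r else reg u (r - k))
    (fun a => if a < k then mem st a else mem u (a - k)) in
  exec ops (shift k p) (lift s) (lift s') t.
Proof.
move=> e lift.
have regE u r : reg (lift u) (k + r) = reg u r.
  by rewrite /= ltnNge leq_addr /= addKn.
have memE u a : mem (lift u) (k + a) = mem u a.
  by rewrite /= ltnNge leq_addr /= addKn.
have liftr u r v : lift (set_reg u r v) = set_reg (lift u) (k + r) v.
  rewrite /set_reg /lift /=; congr State; apply: funext => r' /=.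
  have [r'k|kr'] := ltnP r' k; first by case: eqP => //; lia.
  by congr (if _ then _ else _); lia.
have liftm u a i v : lift (set_mem u a i v) = set_mem (lift u) (k + a) i v.
  rewrite /set_mem /lift /=; congr State; apply: funext => a'; apply: funext => i' /=.
  have [a'k|ka'] := ltnP a' k; first by case: eqP => //; lia.
  by congr (if _ && _ then _ else _); lia.
elim: e => {p s s' t} /=.
- by constructor.
- by move=> r n s; rewrite liftr; constructor.
- by move=> r r' s; rewrite liftr -(regE s r'); constructor.
- by move=> r r' u s; rewrite liftr -(regE s r') -(regE s u); constructor.
- by move=> r r' u s; rewrite liftr -(regE s r') -(regE s u); constructor.
- move=> r f rs s; rewrite liftr.
  rewrite (_ : map (reg s) rs = map (reg (lift s)) (map (addn k) rs)).
    by constructor.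
  by rewrite -map_comp; apply: eq_map => r' /=; rewrite -regE.
- by move=> r a i s; rewrite liftr -(memE s a) -(regE s i); constructor.
- by move=> a i r s; rewrite liftm -(regE s r) -(regE s i); constructor.
- by move=> p1 p2 s s1 s2 t1 t2 _ e1 _ e2; apply: exec_seq e1 e2.
- move=> r p1 p2 s s' t _ e1; constructor; rewrite regE.
  by move: e1; case: ifP.
- by move=> r p s z; constructor; rewrite regE.
- move=> r p s s1 s2 t1 t2 nz _ e1 _ e2; apply: exec_while_step e1 e2.
  by rewrite regE.
Qed.

Lemma runs_shift k p (st : state A) t (Q : state A -> Prop) :
  runs p (State (fun r => reg st (k + r)) (fun a => mem st (k + a))) t Q ->
  runs (shift k p) st t
    (fun st' => Q (State (fun r => reg st' (k + r)) (fun a => mem st' (k + a)))).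
Proof.
move=> [s' [u [/(exec_shift k st) /= e ut q]]].
eexists; exists u; split; [|exact: ut|].
- rewrite [X in exec _ _ X _ _](_ : _ = st) in e; first exact: e.
  case: st => R M /=; congr State; apply: funext => r /=.
    by case: ltnP => // kr; rewrite subnKC.
  by case: ltnP => // kr; rewrite subnKC.
- rewrite /= (_ : State _ _ = s') //; case: s' {e} q => R M q /=.
  congr State; apply: funext => r; by rewrite ltnNge leq_addr /= addKn.
Qed.

End Logic.

(** * Bags presented by lists *)

Definition bag_of (T : Type) (s : seq T) : bag T := seq_mset (s : seq {classic T}).

Lemma bag_ofE (T : Type) (s : seq T) (x : T) :
  bag_of s x = count (fun y => `[< y = x >]) s.
Proof. by rewrite /bag_of mset_seqE. Qed.

Lemma bag_size_bag_of (T : Type) (s : seq T) : bag_size (bag_of s) = size s.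
Proof. exact: perm_size (perm_eq_seq_mset _). Qed.

(** Collects what a loop iteration needs about the [k]-th element: the remaining list, the processed
    prefix, and the array entry, which is an image of the element under some [f]. *)
Lemma split_at (T : Type) (s : seq T) k : k < size s ->
  exists x, [/\ drop k s = x :: drop k.+1 s, take k.+1 s = rcons (take k s) x
    & forall (U : Type) (f : T -> U) u0, nth u0 (map f s) k = f x].
Proof.
elim: s k => // y s IHs [_|k /IHs[x [dE tE nE]]] /=.
  by exists y; rewrite drop0 take0.
by exists x; rewrite dE tE.
Qed.

(** * Linked lists, calls of [merge] and output for a single target block *)

Section Pieces.
Variables (A : Type) (ops : nat -> seq (value A) -> value A).
Implicit Types (st : state A).
Local Notation runs := (halts_within ops).

Lemma array_holds_rcons st st' a (vs : seq (value A)) v :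
  array_holds st a vs ->
  (forall i, i <= size vs -> mem st' a i = if i == size vs then v else mem st a i) ->
  array_holds st' a (rcons vs v).
Proof.
move=> hold E i; rewrite size_rcons ltnS => le; rewrite E // nth_rcons.
have [->|ne] := eqVneq i (size vs); first by rewrite ltnn.
have lt : i < size vs by rewrite ltn_neqAle ne.
by rewrite lt hold.
Qed.

Definition is_label (v : value A) : bool := if v is Lab _ then true else false.

(** Only [Store] changes an array, and it changes one cell per step, so each step creates at most
    one new label there. *)
Lemma exec_labels (p : program) st st' t a N : exec ops p st st' t ->
  count (fun i => is_label (mem st' a i)) (iota 0 N) <=
  count (fun i => is_label (mem st a i)) (iota 0 N) + t.
Proof.
elim=> {p st st' t}; try by move=> *; rewrite /= leq_addr.
- move=> a' i r st.
  apply: leq_trans (_ : count (predU (pred1 (num (reg st i)))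
     (fun j => is_label (mem st a j))) (iota 0 N) <= _).
    apply: sub_count => j /=; case: (j == _) => //=.
    by rewrite andbF.
  apply: leq_trans (leq_addr (count (predI (pred1 (num (reg st i)))
    (fun j => is_label (mem st a j))) (iota 0 N)) _) _.
  rewrite count_predUI addnC leq_add2l count_uniq_mem ?iota_uniq //.
  exact: leq_b1.
- by move=> p1 p2 st st1 st2 t1 t2 _ h1 _ h2; lia.
- by move=> r p1 p2 st st' t _ h; lia.
- by move=> r p st st1 st2 t1 t2 _ _ h1 _ h2; lia.
Qed.

(* [h] is a linked list with labels [s]; a link to cell [e] is stored as [e.+1],
   and [0] ends the list. *)
Fixpoint chain (lab next : nat -> value A) (u h : nat) (s : seq A) : Prop :=
  if s is a :: s' then
    exists e h', [/\ h = e.+1, e < u, lab e = Lab a, next e = Num h'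
      & chain lab next u h' s']
  else h = 0.

(** Links are created at cell [u] and beyond, so lists living below [u] survive. *)
Lemma chain_extend lab next next' u u' h s :
  u <= u' -> (forall e, e < u -> next' e = next e) ->
  chain lab next u h s -> chain lab next' u' h s.
Proof.
move=> uu E; elim: s h => //= a s IHs h [e [h' [-> eu le ne c]]].
by exists e, h'; rewrite E //; split=> //; [lia|apply: IHs].
Qed.

(* The arrays and registers of the program for [merge] are shifted by 16. Below
   16, registers 0 and 1 hold the numbers of nodes and blocks, 2 and 5 the
   constants 1 and 0, 3 a loop variable, 4 a loop guard, 6 the target block of an
   edge, 7 the number of edges output so far, 8 the current block, 10 and 11 the
   bounds of the adjacency list of its representative, 12 a link, and 9, 13 and
   14 are scratch. Arrays 0 to 3 hold the input, 4 the heads of the lists, 5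
   their links, 6 the representatives; 7, 8 and 9 collect what finally goes to
   0, 1 and 2. *)
Definition traverse : program :=
  While 12 (Sub 12 12 2 ;; Fetch 13 1 12 ;; Store 16 16 13 ;; Add 16 16 2 ;;
            Fetch 12 5 12).

(** A link has the position of its edge as address, so its label is read directly from array 1. Each
    link costs five commands and a test. *)
Lemma runs_traverse st u h s :
  reg st 2 = Num 1 -> reg st 12 = Num h -> reg st 16 = Num 0 ->
  chain (mem st 1) (mem st 5) u h s ->
  runs traverse st (6 * size s).+1 (fun st' =>
    reg st' 16 = Num (size s) /\ array_holds st' 16 (map (@Lab A) s)).
Proof.
move=> r2 r12 r16 c.
pose Inv k st' := exists h', [/\ reg st' 12 = Num h',
  chain (mem st 1) (mem st 5) u h' (drop k s), reg st' 16 = Num k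
  & array_holds st' 16 (map (@Lab A) (take k s))].
apply: (@runs_weaken _ _ _ _ (6 * (size s - 0)).+1 _ (Inv (size s))).
- by rewrite subn0.
- by move=> st' [h' [_ _ -> H]] _; rewrite take_size in H.
apply: (@runs_while _ _ _ _ _ _ Inv (fun k => 6 * (size s - k))).
- by exists h; rewrite drop0 take0; split.
- by move=> st' _ [h' [->]]; rewrite drop_size.
move=> k st' ks [fr fm] [h' [r12' c' r16' h16]].
have [x [dE tE _]] := split_at ks.
move: c'; rewrite dE => -[e [h2 [hE eu le ne c2]]].
rewrite r12' hE; split=> //; exists 5; first by lia.
have m1 := fm 1 isT; have m5 := fm 5 isT; have r2' := fr 2 isT.
do 4![apply: runs_step_seq => //=]; apply: runs_step => //=.
exists h2; rewrite /= m5 r12' r2' r2 r16' hE /= subn1 /= ne addn1; split=> //.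
rewrite tE map_rcons; apply: array_holds_rcons h16 _ => i _ /=.
by rewrite m1 le size_map size_take ks.
Qed.

Variable m : nat.

Definition output st (ol : seq (A * 'I_m)) : Prop :=
  [/\ reg st 7 = Num (size ol), array_holds st 8 [seq Lab p.1 | p <- ol]
    & array_holds st 9 [seq Num (nat_of_ord p.2) | p <- ol]].

Definition emit : program :=
  Const 13 0 ;;
  for_to 13 16 (Fetch 14 16 13 ;; Store 8 7 14 ;; Store 9 7 6 ;; Add 7 7 2).

Lemma runs_emit st (y : 'I_m) (s : seq A) ol :
  reg st 2 = Num 1 -> reg st 6 = Num y -> reg st 16 = Num (size s) ->
  array_holds st 16 (map (@Lab A) s) -> output st ol ->
  runs emit st (7 * size s + 3) (fun st' => output st' (ol ++ [seq (a, y) | a <- s])).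
Proof.
move=> r2 r6 r16 h16 out; apply: runs_step_seq => //=; first by lia.
pose Inv k st' := output st' (ol ++ [seq (a, y) | a <- take k s]).
apply: (@runs_weaken _ _ _ _ (7 * (size s - 0)).+2 _
  (fun st' => Inv (size s) st' /\ reg st' 13 = Num (0 + size s))).
- by rewrite subn0; lia.
- by move=> st' [+ _] _; rewrite /Inv take_size.
apply: (@runs_for _ _ _ _ _ _ _ _ Inv (fun k => 7 * (size s - k))) => //=.
- by rewrite /Inv take0 cats0.
move=> k st' ks [fr fm] ri [o7 o8 o9]; exists 4; first by lia.
have [x [_ tE nE]] := split_at ks.
have /= r2' := fr 2 isT; have /= r6' := fr 6 isT; have /= m16 := fm 16 isT.
do 3![apply: runs_step_seq => //=]; apply: runs_step => //=.
rewrite /Inv tE map_rcons -rcons_cat; split=> /=.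
- by rewrite o7 r2' r2 size_rcons /= addn1.
- rewrite map_rcons; apply: array_holds_rcons o8 _ => i _ /=.
  by rewrite o7 ri m16 h16 ?size_map //= nE.
- rewrite map_rcons; apply: array_holds_rcons o9 _ => i _ /=.
  by rewrite o7 r6' r6 size_map.
Qed.

Variables (merge : bag A -> bag A) (mp : program) (km : nat).
Hypothesis merge_time : forall b st, bag_at b st ->
  runs mp st (km * (bag_size b).+1) (bag_at (merge b)).

(* Run [merge] on an array that holds numbers past the end of the input: each
   further label of the output takes a step to write. *)
Lemma merge_size (s s' : seq A) :
  bag_of s' = merge (bag_of s) -> size s' <= km.+1 * (size s).+1.
Proof.
move=> E.
pose st := State (fun=> Num (size s)) (fun _ => nth (Num 0) (map (@Lab A) s)).
have [|st' [t [e le [s2 [s2E _ hold]]]]] := @merge_time (bag_of s) st.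
  by exists s.
have -> : size s' = size s2.
  by rewrite -bag_size_bag_of -(bag_size_bag_of s2) E -s2E.
move: le; rewrite bag_size_bag_of => le.
have := exec_labels 0 (size s2) e.
rewrite (_ : count _ _ = size s2); last first.
  rewrite -[RHS](size_iota 0); apply/eqP; rewrite -all_count.
  apply/allP => i; rewrite mem_iota add0n => /= lt; rewrite hold ?size_map //.
  by have [x [_ _ ->]] := split_at lt.
suff : count (fun i => is_label (mem st 0 i)) (iota 0 (size s2)) <= size s by lia.
have sz : size [seq i <- iota 0 (size s2) | i < size s] <= size s.
  rewrite -[X in _ <= X](size_iota 0); apply: uniq_leq_size.
    by rewrite filter_uniq ?iota_uniq.
  by move=> i; rewrite mem_filter !mem_iota add0n => /andP[].
apply: leq_trans sz; rewrite size_filter; apply: sub_count => i /=.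
by apply: contraTT; rewrite -leqNgt => le'; rewrite nth_default ?size_map.
Qed.

Lemma runs_merge st (s : seq A) :
  reg st 16 = Num (size s) -> array_holds st 16 (map (@Lab A) s) ->
  runs (shift 16 mp) st (km * (size s).+1) (fun st' => exists s',
    [/\ bag_of s' = merge (bag_of s), reg st' 16 = Num (size s')
      & array_holds st' 16 (map (@Lab A) s')]).
Proof.
move=> r16 h16; rewrite -(bag_size_bag_of s).
have b : bag_at (bag_of s)
    (State (fun r => reg st (16 + r)) (fun a => mem st (16 + a))) by exists s.
by apply: runs_weaken (runs_shift (merge_time b)) => // st' [s' [? ? ?]] _; exists s'.
Qed.

(** The head is reset while register 12 still holds the first link; later edges into the same block
    then find an empty list. *)
Definition flush : program :=
  Store 4 6 5 ;; Const 16 0 ;; traverse ;; shift 16 mp ;; emit.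

Lemma runs_flush st (y : 'I_m) u h s ol :
  reg st 2 = Num 1 -> reg st 5 = Num 0 -> reg st 6 = Num y -> reg st 12 = Num h ->
  chain (mem st 1) (mem st 5) u h s -> output st ol ->
  runs flush st ((8 * km + 20) * (size s).+1) (fun st' =>
    exists s', [/\ bag_of s' = merge (bag_of s),
      output st' (ol ++ [seq (a, y) | a <- s'])
    & forall i, mem st' 4 i = if i == y :> nat then Num 0 else mem st 4 i]).
Proof.
move=> r2 r5 r6 r12 c [o7 o8 o9].
(* Traversal, [merge], and emission, where [merge_size] bounds the number of labels emitted. *)
apply: (@runs_leq _ _ _ _ ((6 * size s).+1 + (km * (size s).+1 +
  (7 * (km.+1 * (size s).+1) + 3))).+2); first by nia.
do 2![apply: runs_step_seq => //=].
apply: runs_seq; first exact: (@runs_traverse _ u h s).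
move=> st1 [r16 h16] [/= fr1 fm1].
apply: runs_seq; first by apply: runs_merge h16.
move=> st2 [s' [sE r16' h16']] [fr2 fm2].
have sz := merge_size sE.
have R r : r < 16 -> r \notin [:: 12; 13] -> reg st2 r = reg st r.
  rewrite !inE negb_or => r16b /andP[a b]; rewrite fr2 ?writes_reg_shift // fr1.
    by rewrite /= ifN // ltn_eqF.
  by rewrite ?(negbTE a) ?(negbTE b) ltn_eqF.
have M a : a < 16 -> mem st2 a = mem st1 a.
  by move=> a16; rewrite fm2 // writes_mem_shift.
have M1 a : a < 16 -> a != 4 -> mem st2 a = mem st a.
  move=> a16 a4; rewrite M // fm1; last by rewrite /= ?ltn_eqF.
  by apply: funext => i; rewrite /= (negbTE a4).
have out2 : output st2 ol by split; rewrite ?R // /array_holds M1.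
apply: runs_weaken (runs_emit (y := y) _ _ r16' h16' out2); rewrite ?R //.
- by rewrite leq_add2r leq_mul2l sz.
- move=> st3 out [_ fm3]; exists s'; split=> // i.
  by rewrite fm3 // M // fm1 //= r6 r5.
Qed.

End Pieces.

(** * Grouping the edges of a node by target block *)

Section Grouping.
Variables (A : Type) (n m : nat) (beta : 'I_n -> 'I_m).
Implicit Types (es : seq (A * 'I_n)) (y : 'I_m).

(* Reversed because linked lists grow at the front. *)
Definition labels_to es y : seq A := rev [seq p.1 | p <- es & beta p.2 == y].

Lemma labels_to_rcons es p y :
  labels_to (rcons es p) y =
  if y == beta p.2 then p.1 :: labels_to es y else labels_to es y.
Proof.
rewrite /labels_to filter_rcons eq_sym; case: ifP => // _.
by rewrite map_rcons rev_rcons.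
Qed.

Definition blocks_of es : seq 'I_m := [seq beta p.2 | p <- es].

Lemma labels_to_nil es y : y \notin blocks_of es -> labels_to es y = [::].
Proof.
elim: es => //= p es IHes; rewrite inE negb_or eq_sym => /andP[/negbTE ne /IHes].
by rewrite /labels_to /= ne.
Qed.

Lemma labels_to_pos es k p y : take k.+1 es = rcons (take k es) p ->
  y = beta p.2 -> 0 < size (labels_to es y).
Proof.
move=> tE ->; rewrite -(cat_take_drop k.+1 es) tE /labels_to filter_cat.
by rewrite filter_rcons eqxx map_cat map_rcons size_rev size_cat size_rcons.
Qed.

(** The potential of the second pass: edges whose target block has not been flushed yet. *)
Definition unseen es (seen : seq 'I_m) : nat :=
  count (fun p => beta p.2 \notin seen) es.

(** Flushing a new block releases one unit per edge into it, which is the length of the list being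
    flushed; each edge thus pays for one flush only. *)
Lemma unseen_rcons es seen y : unseen es seen =
  unseen es (rcons seen y) + (if y \in seen then 0 else size (labels_to es y)).
Proof.
rewrite /labels_to size_rev size_map /unseen; elim: es => [|p es IHes] /=.
  by case: ifP.
rewrite IHes mem_rcons inE; have [->|] := eqVneq (beta p.2) y => /=.
  by case: (y \in seen) => //=; lia.
by case: (_ \notin _); case: ifP => /= _ _; lia.
Qed.

End Grouping.

(** * The two passes over the edges of one representative *)

Section Passes.
Variables (A : Type) (ops : nat -> seq (value A) -> value A).
Variables (n m : nat) (beta : 'I_n -> 'I_m).
Variables (merge : bag A -> bag A) (mp : program) (km : nat).
Hypothesis merge_time : forall b st, bag_at b st ->
  halts_within ops mp st (km * (bag_size b).+1) (bag_at (merge b)).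
Hypothesis merge0 : merge (bag_of [::]) = bag_of [::].
Implicit Types (st : state A) (es : seq (A * 'I_n)) (y : 'I_m).
Local Notation runs := (halts_within ops).
Local Notation labels_to := (labels_to beta).
Local Notation blocks_of := (blocks_of beta).

Definition blocks_at st : Prop := forall x : 'I_n, mem st 3 x = Num (beta x).

Definition edges_at st (lo : nat) es : Prop := forall k, k < size es ->
  mem st 1 (lo + k) = nth (Num 0) [seq Lab p.1 | p <- es] k /\
  mem st 2 (lo + k) = nth (Num 0) [seq Num (nat_of_ord p.2) | p <- es] k.

Definition buckets_at st u (s : 'I_m -> seq A) : Prop :=
  forall y, exists h, mem st 4 y = Num h /\ chain (mem st 1) (mem st 5) u h (s y).

Definition bucket : program :=
  Move 3 10 ;;
  for_to 3 11 (Fetch 6 2 3 ;; Fetch 6 3 6 ;; Fetch 12 4 6 ;; Store 5 3 12 ;;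
               Add 12 3 2 ;; Store 4 6 12).

(** The edge at position [lo + k] uses cell [lo + k] of array 5 as its link. Fresh cells thus come
    for free, and since chains mention only cells below [lo + k], array 5 needs no
    initialisation. *)
Lemma runs_bucket st lo es :
  reg st 2 = Num 1 -> reg st 10 = Num lo -> reg st 11 = Num (lo + size es) ->
  blocks_at st -> edges_at st lo es -> (forall y, mem st 4 y = Num 0) ->
  runs bucket st (9 * size es + 3)
    (fun st' => buckets_at st' (lo + size es) (labels_to es)).
Proof.
move=> r2 r10 r11 hb he hh; apply: runs_step_seq => //=; first by lia.
pose Inv k st' := mem st' 1 = mem st 1 /\
  buckets_at st' (lo + k) (labels_to (take k es)).
apply: (@runs_weaken _ _ _ _ (9 * (size es - 0)).+2 _
  (fun st' => Inv (size es) st' /\ reg st' 3 = Num (lo + size es))).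
- by rewrite subn0; lia.
- by move=> st' [[_ +] _] _; rewrite take_size.
apply: (@runs_for _ _ _ _ _ _ _ _ Inv (fun k => 9 * (size es - k))) => //=.
- by split=> // y; exists 0; rewrite take0 /= hh.
move=> k st' ks [fr fm] ri [m1 I]; exists 6; first by lia.
have [p [_ tE nE]] := split_at ks.
have [le te] := he _ ks; rewrite !nE in le te.
have /= r2' := fr 2 isT; have /= m2 := fm 2 isT; have /= m3 := fm 3 isT.
do 5![apply: runs_step_seq => //=]; apply: runs_step => //=.
split=> //= y; rewrite tE labels_to_rcons /= !ri m2 /= te m3 /= hb /= r2' r2 /=.
have [-> |ne] := eqVneq y (beta p.2).
  have [h [hE c]] := I (beta p.2).
  exists (lo + k + 1); rewrite eqxx; split=> //; exists (lo + k), h.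
  rewrite eqxx m1; split=> //; [by rewrite addn1|by rewrite addnS|].
  rewrite -m1; apply: chain_extend c => [|e ek]; first by rewrite addnS.
  by rewrite ltn_eqF.
have [h [hE c]] := I y; exists h.
rewrite (negbTE (_ : y != beta p.2 :> nat)) //; split=> //.
by apply: chain_extend c => [|e ek] /=; [lia|rewrite ltn_eqF].
Qed.

Definition merged es (ol : seq (A * 'I_m)) : Prop := forall a y,
  count (fun p => `[< p = (a, y) >]) ol = merge (bag_of (labels_to es y)) a.

Lemma count_to (s : seq A) a y y' :
  count (fun p => `[< p = (a, y) >]) [seq (a', y') | a' <- s] =
  if y == y' then bag_of s a else 0.
Proof.
rewrite bag_ofE count_map; elim: s => [|a' s /= ->] /=; first by case: ifP.
have [->|ne] := eqVneq y y'.
  by congr (nat_of_bool _ + _); apply/asboolP/asboolP => [[]|->].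
by rewrite asboolF // => -[_ /esym/eqP]; apply/negP.
Qed.

Definition collect : program :=
  Move 3 10 ;;
  for_to 3 11 (Fetch 6 2 3 ;; Fetch 6 3 6 ;; Fetch 12 4 6 ;;
               If 12 (flush mp) Skip).

(** The head tells whether a block was flushed: if not, its list still contains the edge at hand and
    is nonempty. So every target block is flushed exactly once, at its first edge. *)
Lemma runs_collect st lo es ol :
  reg st 2 = Num 1 -> reg st 5 = Num 0 ->
  reg st 10 = Num lo -> reg st 11 = Num (lo + size es) ->
  blocks_at st -> edges_at st lo es -> output st ol ->
  buckets_at st (lo + size es) (labels_to es) ->
  runs collect st ((16 * km + 48) * size es + 3) (fun st' => exists ol',
    [/\ output st' (ol ++ ol'), size ol' <= 2 * km.+1 * size es,
        merged es ol' & forall y, mem st' 4 y = Num 0]).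
Proof.
move=> r2 r5 r10 r11 hb he out hh; apply: runs_step_seq => //=; first by lia.
pose N := size es.
pose seen k := blocks_of (take k es).
(* Labels and links are those of [st]: only the heads change. *)
pose Inv k st' :=
  buckets_at (State (reg st) (fun a => if a == 4 then mem st' 4 else mem st a))
    (lo + N) (fun y => if y \in seen k then [::] else labels_to es y) /\
  exists ol', [/\ output st' (ol ++ ol'),
    size ol' + 2 * km.+1 * unseen beta es (seen k) <= 2 * km.+1 * N
    & forall a y, count (fun p => `[< p = (a, y) >]) ol' =
        if y \in seen k then merge (bag_of (labels_to es y)) a else 0].
(* Scanning costs at most 8 per edge. A flushed list is nonempty, so its length plus one is at most
   twice its length; this doubles the constants of [runs_flush], and likewise those of [merge_size]
   in the output bound. *)
pose pot k := 8 * (N - k) + (16 * km + 40) * unseen beta es (seen k).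
have seen0 : unseen beta es [::] <= N by apply: count_size.
apply: (@runs_weaken _ _ _ _ (pot 0).+2 _
  (fun st' => Inv N st' /\ reg st' 3 = Num (lo + N))).
- by rewrite /pot /seen take0 subn0; move: seen0; rewrite /N /=; nia.
- move=> st' [[hb' [ol' [o1 o2 o3]]] _] _; exists ol'.
  rewrite /seen take_size in o2 o3 hb'.
  split=> //; first by lia.
    (* A block not seen by the end receives no edge, and [merge] of the empty bag is empty. *)
    move=> a y; rewrite o3; case: ifP => // /negbT nin.
    by rewrite labels_to_nil // merge0 bag_ofE.
  move=> y; have [h [/= -> c]] := hb' y.
  have -> // : h = 0.
  by move: c; case: ifP => // /negbT nin; rewrite labels_to_nil.
have wr r : r < 16 -> r \notin [:: 6; 7; 12; 13; 14; 4] ->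
    writes_reg (Fetch 6 2 3 ;; Fetch 6 3 6 ;; Fetch 12 4 6 ;;
                If 12 (flush mp) Skip) r = false.
  move=> r16; rewrite !inE => /norP[a /norP[b /norP[c /norP[d /norP[e f]]]]].
  rewrite /= writes_reg_shift // (negbTE a) (negbTE b) (negbTE c) (negbTE d).
  by rewrite (negbTE e) (negbTE f) ltn_eqF.
apply: (@runs_for _ _ _ _ _ _ _ _ Inv pot); rewrite ?wr //.
- split=> /=; last first.
    exists [::]; rewrite cats0; split=> //.
      by rewrite /seen take0 add0n leq_mul2l; apply/orP; right.
    by move=> a y; rewrite /seen take0.
  move=> y; have [h [hE c]] := hh y; exists h.
  by rewrite /= /seen take0.
move=> k st' ks [fr fm] ri [hb' [ol' [o1 o2 o3]]].
have [p [_ tE nE]] := split_at ks.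
have [le te] := he _ ks; rewrite !nE in le te.
have R r : r < 16 -> r \notin [:: 3; 6; 7; 12; 13; 14; 4] -> reg st' r = reg st r.
  rewrite inE => r16 /norP[r3 rr]; rewrite fr /=; first by rewrite (negbTE r3).
  have := wr _ r16 rr; rewrite /= => ->; rewrite (negbTE r3).
  by move: rr; rewrite !inE => /norP[_ /norP[_ /norP[_ /norP[_ /norP[_ /negbTE->]]]]].
have M a : a < 16 -> a \notin [:: 4; 8; 9] -> mem st' a = mem st a.
  rewrite !inE => a16 /norP[a4 /norP[a8 a9]]; rewrite fm //=.
  by rewrite writes_mem_shift // (negbTE a4) (negbTE a8) (negbTE a9) ltn_eqF.
have seenS : seen k.+1 = rcons (seen k) (beta p.2).
  by rewrite /seen tE /blocks_of map_rcons.
have pos := labels_to_pos tE (erefl (beta p.2)).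
have uE := unseen_rcons beta es (seen k) (beta p.2).
have [h [/= hE c]] := hb' (beta p.2).
(* Either the block was flushed before, its head is 0 and the edge is skipped, or its whole list is
   flushed now. *)
rewrite /pot seenS; move: uE c; case: ifP => [inS|ninS] uE c.
  exists 5; first by rewrite uE; lia.
  do 3![apply: runs_step_seq => //=].
  rewrite !ri M //= te M //= hb /= hE c.
  apply: runs_if => /=; apply: runs_step => //=; split=> /=.
    move=> y; have [h' [hE' c']] := hb' y; exists h'; split=> //=.
    move: c'; rewrite seenS mem_rcons inE.
    by have [->|] := eqVneq y (beta p.2); rewrite ?inS.
  exists ol'; rewrite seenS; split=> //; first by lia.
  move=> a y; rewrite o3 mem_rcons inE.
  by have [->|] := eqVneq y (beta p.2); rewrite ?inS.
exists ((8 * km + 20) * (size (labels_to es (beta p.2))).+1 + 4).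
  by rewrite uE; nia.
have hpos : h != 0.
  by move: c pos; case: labels_to => // a s [e [h' [->]]].
rewrite addnS addnS addnS addnS addn0.
do 3![apply: runs_step_seq => //=].
rewrite !ri M //= te M //= hb /= hE.
apply: runs_if => /=; rewrite hpos.
have c2 : chain (mem st' 1) (mem st' 5) (lo + N) h (labels_to es (beta p.2)).
  by rewrite !M.
set s1 := set_reg _ 12 _.
have o1s : output s1 (ol ++ ol') by [].
have c1 : chain (mem s1 1) (mem s1 5) (lo + N) h (labels_to es (beta p.2)) by [].
apply: runs_weaken (runs_flush (y := beta p.2) merge_time _ _ _ _ c1 o1s);
  rewrite /= ?R //.
move=> st2 [s' [sE o1' h4]] _.
have sz := merge_size merge_time sE.
split.
  move=> y; have [h' [/= hE' c']] := hb' y.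
  rewrite seenS mem_rcons inE /= h4 /= val_eqE.
  case: eqP => [_|_]; first by exists 0.
  by exists h'.
exists (ol' ++ [seq (a, beta p.2) | a <- s']); rewrite catA; split=> //.
  by rewrite seenS size_cat size_map; nia.
move=> a y; rewrite count_cat count_to o3 sE seenS mem_rcons inE.
have [->|] := eqVneq y (beta p.2); first by rewrite ninS.
by rewrite addn0.
Qed.

End Passes.

(** * Boundaries of adjacency lists and the loop over the blocks *)

(** Only the left ends of the lists: these are known before each list is written, while the final
    total is appended after the loop. *)
Definition bounds (A T : Type) (ss : seq (seq T)) : seq (value A) :=
  [seq Num (sumn (take k (shape ss))) | k <- iota 0 (size ss)].

Lemma boundsS A T (ss : seq (seq T)) :
  [seq Num (sumn (take k (shape ss))) | k <- iota 0 (size ss).+1] =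
  rcons (bounds A ss) (Num (size (flatten ss))).
Proof.
rewrite -addn1 iotaD cats1 map_rcons add0n; congr (rcons _ (Num _)).
by rewrite take_oversize ?size_map // size_flatten.
Qed.

Lemma bounds_rcons A T (ss : seq (seq T)) c :
  bounds A (rcons ss c) = rcons (bounds A ss) (Num (size (flatten ss))).
Proof.
rewrite -boundsS /bounds size_rcons; apply/eq_in_map => k.
rewrite mem_iota ltnS => /= le.
by rewrite /shape map_rcons -cats1 takel_cat ?size_map.
Qed.

Lemma sum_ord_tail m (f : 'I_m -> nat) k (lt : k < m) :
  \sum_(y < m | k <= y) f y = f (Ordinal lt) + \sum_(y < m | k < y) f y.
Proof.
rewrite (bigD1 (Ordinal lt)) //=; congr (_ + _); apply: eq_bigl => y.
by rewrite -val_eqE /= ltn_neqAle eq_sym andbC.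
Qed.

Section Quotient.
Variables (A : Type) (ops : nat -> seq (value A) -> value A).
Variables (merge : bag A -> bag A) (mp : program) (km : nat).
Hypothesis merge_time : forall b st, bag_at b st ->
  halts_within ops mp st (km * (bag_size b).+1) (bag_at (merge b)).
Hypothesis merge0 : merge (bag_of [::]) = bag_of [::].
Implicit Types (st : state A).
Local Notation runs := (halts_within ops).

Definition copy (a b r : nat) : program :=
  Const 3 0 ;; for_to 3 r (Fetch 13 a 3 ;; Store b 3 13).

Lemma runs_copy st a b r (vs : seq (value A)) :
  a != b -> r \notin [:: 2; 3; 4; 13] -> reg st 2 = Num 1 ->
  reg st r = Num (size vs) -> array_holds st a vs ->
  runs (copy a b r) st (5 * size vs + 3) (fun st' => array_holds st' b vs).
Proof.
move=> ab; rewrite !inE => /norP[rn2 /norP[rn3 /norP[rn4 rn13]]] r2 rr ha.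
apply: runs_step_seq => //=; first by lia.
pose Inv k st' := array_holds st' b (take k vs).
apply: (@runs_weaken _ _ _ _ (5 * (size vs - 0)).+2 _
  (fun st' => Inv (size vs) st' /\ reg st' 3 = Num (0 + size vs))).
- by rewrite subn0; lia.
- by move=> st' [+ _] _; rewrite /Inv take_size.
apply: (@runs_for _ _ _ _ _ _ _ _ Inv (fun k => 5 * (size vs - k))) => //=.
- by rewrite !inE eq_sym (negbTE rn3).
- by rewrite !inE (negbTE rn2) (negbTE rn4).
- by rewrite orbF.
- by rewrite (negbTE rn3).
- by rewrite /Inv take0.
move=> k st' ks [fr fm] ri I; exists 2; first by lia.
have [v [_ tE nE]] := split_at ks.
apply: runs_step_seq => //=; apply: runs_step => //=.
rewrite /Inv tE; apply: array_holds_rcons I _ => i _ /=.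
rewrite eqxx ri /= (fm a) /= ?orbF // ha // size_takel ?(ltnW ks) //.
by have := nE _ id (Num 0); rewrite map_id => ->.
Qed.

Variables (n m : nat) (beta : 'I_n -> 'I_m) (l : 'I_n -> seq (A * 'I_n)).

Definition graph_at st : Prop := forall x : 'I_n, exists lo,
  [/\ mem st 0 x = Num lo, mem st 0 x.+1 = Num (lo + size (l x))
    & edges_at st lo (l x)].

Definition node : program :=
  Store 7 8 7 ;; Fetch 9 6 8 ;; Fetch 10 0 9 ;; Add 9 9 2 ;; Fetch 11 0 9 ;;
  bucket ;; collect mp.

Definition written st (rep : 'I_m -> 'I_n) (chunks : seq (seq (A * 'I_m))) : Prop :=
  [/\ forall y : 'I_m, y < size chunks ->
        merged beta merge (l (rep y)) (nth [::] chunks y),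
      output st (flatten chunks)
    & array_holds st 7 (bounds A chunks)].

(** Between rounds all heads are zero, because [collect] empties every list that [bucket] filled.
    Hence a round costs a constant plus the edges of one representative. *)
Lemma runs_nodes st (rep : 'I_m -> 'I_n) :
  reg st 1 = Num m -> reg st 2 = Num 1 -> reg st 5 = Num 0 ->
  reg st 7 = Num 0 -> reg st 8 = Num 0 ->
  blocks_at beta st -> graph_at st ->
  (forall y : 'I_m, mem st 4 y = Num 0) ->
  (forall y : 'I_m, mem st 6 y = Num (rep y)) ->
  runs (for_to 8 1 node) st
    (14 * m + (16 * km + 57) * (\sum_(y < m) size (l (rep y))) + 2)
    (fun st' => reg st' 8 = Num m /\ exists chunks, [/\ size chunks = m,
       size (flatten chunks) <= 2 * km.+1 * \sum_(y < m) size (l (rep y))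
     & written st' rep chunks]).
Proof.
move=> r1 r2 r5 r7 r8 hb hg h4 h6.
pose tail k := \sum_(y < m | k <= y) size (l (rep y)).
have -> : \sum_(y < m) size (l (rep y)) = tail 0 by [].
pose Inv k st' := (forall y : 'I_m, mem st' 4 y = Num 0) /\
  exists chunks, [/\ size chunks = k,
    size (flatten chunks) + 2 * km.+1 * tail k <= 2 * km.+1 * tail 0
  & written st' rep chunks].
(* Here [57] is [9 + 48] from the two passes, and [14] adds up the five commands before them, their
   constants [3 + 3], and three steps of loop overhead. *)
pose pot k := 14 * (m - k) + (16 * km + 57) * tail k.
apply: (@runs_weaken _ _ _ _ (pot 0).+2 _
  (fun st' => Inv m st' /\ reg st' 8 = Num (0 + m))).
- by rewrite /pot subn0 addn2.
- move=> st' [[_ [chunks [sz out w]]] r8'] _; split=> //.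
  by exists chunks; split=> //; lia.
have wr r : r < 16 -> r \notin [:: 3; 4; 6; 7; 9; 10; 11; 12; 13; 14] ->
    writes_reg node r = false.
  move=> r16; rewrite !inE /= => ne; rewrite writes_reg_shift //.
  by apply/negbTE; lia.
have wm a : a < 16 -> a \notin [:: 4; 5; 7; 8; 9] -> writes_mem node a = false.
  move=> a16; rewrite !inE /= => ne; rewrite writes_mem_shift //.
  by apply/negbTE; lia.
apply: (@runs_for _ _ _ _ _ _ _ _ Inv pot); rewrite ?wr //.
  split=> //; exists [::]; rewrite /= add0n; split=> //; split=> //.
move=> k st' km' [fr fm] ri [h4' [chunks [sz out [w1 w2 w3]]]].
have R r : r < 16 -> r \notin [:: 3; 4; 6; 7; 8; 9; 10; 11; 12; 13; 14] ->
    reg st' r = reg st r.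
  by move=> r16; rewrite !inE => ne; rewrite fr // writes_reg_for wr ?inE; lia.
have M a : a < 16 -> a \notin [:: 4; 5; 7; 8; 9] -> mem st' a = mem st a.
  by move=> a16 ne; rewrite fm // writes_mem_for wm.
set y := Ordinal km'.
have tE : tail k = size (l (rep y)) + tail k.+1 by apply: sum_ord_tail.
have [lo [lo0 lo1 he]] := hg (rep y).
have h6' : mem st 6 k = Num (rep y) by rewrite -h6.
have [o7 o8 o9] := w2.
exists (5 + (9 * size (l (rep y)) + 3 + ((16 * km + 48) * size (l (rep y)) + 3))).
  by rewrite /pot tE; nia.
do 5![apply: runs_step_seq => //=].
rewrite o7 ri !M //= h6' /= lo0 R // r2 /= addn1 lo1.
set s1 := set_reg _ 11 _.
have hb1 : blocks_at beta s1 by rewrite /blocks_at /= M.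
have he1 : edges_at s1 lo (l (rep y)) by rewrite /edges_at /= !M.
apply: (@runs_seq _ _ _ _ _ (9 * size (l (rep y)) + 3)
  ((16 * km + 48) * size (l (rep y)) + 3)).
  apply: (runs_bucket ops (beta := beta) (lo := lo) (es := l (rep y))) => //=.
  by rewrite R.
move=> s2 hbk [fr2 fm2].
have hb2 : blocks_at beta s2 by rewrite /blocks_at fm2.
have he2 : edges_at s2 lo (l (rep y)) by rewrite /edges_at !fm2.
have out2 : output s2 (flatten chunks) by rewrite /output /array_holds !fr2 // !fm2.
apply: runs_weaken (runs_collect merge_time merge0 _ _ _ _ hb2 he2 out2 hbk);
  rewrite ?fr2 //= ?R //.
move=> s3 [ol' [o1 o2 o3 o4]] [fr3 fm3]; split=> //.
exists (rcons chunks ol'); rewrite size_rcons flatten_rcons size_cat sz.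
split=> //; first by rewrite tE in out; nia.
split.
- move=> z; rewrite size_rcons ltnS nth_rcons leq_eqVlt => /orP[/eqP zE|lt].
    by rewrite zE ltnn eqxx (_ : z = y) //; apply: val_inj; rewrite /= zE sz.
  by rewrite lt; apply: w1.
- by rewrite flatten_rcons.
rewrite bounds_rcons; apply: array_holds_rcons w3 _ => i _.
rewrite fm3 /= ?writes_mem_shift // fm2 //= /bounds size_map size_iota.
by rewrite sz.
Qed.

End Quotient.

(** * The whole program on arrays *)

Section QuotientProgram.
Variables (A : Type) (ops : nat -> seq (value A) -> value A).
Variables (merge : bag A -> bag A) (mp : program) (km : nat).
Hypothesis merge_time : forall b st, bag_at b st ->
  halts_within ops mp st (km * (bag_size b).+1) (bag_at (merge b)).
Hypothesis merge0 : merge (bag_of [::]) = bag_of [::].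
Implicit Types (st : state A).
Local Notation runs := (halts_within ops).
Variables (n m : nat) (beta : 'I_n -> 'I_m) (l : 'I_n -> seq (A * 'I_n)).
Hypothesis beta_surj : forall y, exists x, beta x = y.

Definition clear : program := Const 3 0 ;; for_to 3 1 (Store 4 3 5).

Lemma runs_clear st :
  reg st 1 = Num m -> reg st 2 = Num 1 -> reg st 5 = Num 0 ->
  runs clear st (4 * m + 3) (fun st' => forall y : 'I_m, mem st' 4 y = Num 0).
Proof.
move=> r1 r2 r5; apply: runs_step_seq => //=; first by lia.
pose Inv k st' := forall i, i < k -> mem st' 4 i = Num 0 :> value A.
apply: (@runs_weaken _ _ _ _ (4 * (m - 0)).+2 _
  (fun st' => Inv m st' /\ reg st' 3 = Num (0 + m))).
- by rewrite subn0; lia.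
- by move=> st' [I _] _ y; apply: I.
apply: (@runs_for _ _ _ _ _ _ _ _ Inv (fun k => 4 * (m - k))) => //=.
move=> k st' km' [fr fm] ri I; exists 1; first by lia.
apply: runs_step => //= i; rewrite ltnS leq_eqVlt /= ri.
case: eqP => [_ _|_ /I //]; by rewrite fr.
Qed.

Definition represent : program :=
  Const 3 0 ;; for_to 3 0 (Fetch 6 3 3 ;; Store 6 6 3).

(** Each node overwrites the entry of its block, so any entry written holds some member of that
    block. By surjectivity of [beta] every entry gets written. *)
Lemma runs_represent st :
  reg st 0 = Num n -> reg st 2 = Num 1 -> blocks_at beta st ->
  runs represent st (5 * n + 3) (fun st' => exists rep : 'I_m -> 'I_n,
    cancel rep beta /\ forall y : 'I_m, mem st' 6 y = Num (rep y)).
Proof.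
move=> r0 r2 hb; apply: runs_step_seq => //=; first by lia.
pose Inv k st' := forall x : 'I_n, x < k ->
  exists2 x', beta x' = beta x & mem st' 6 (beta x) = Num (nat_of_ord x') :> value A.
apply: (@runs_weaken _ _ _ _ (5 * (n - 0)).+2 _
  (fun st' => Inv n st' /\ reg st' 3 = Num (0 + n))).
- by rewrite subn0; lia.
- move=> st' [I _] _.
  have /fin_all_exists[rep repP] (y : 'I_m) :
      exists x, beta x = y /\ mem st' 6 y = Num (nat_of_ord x).
    by have [x <-] := beta_surj y; have [x' ? ?] := I x (ltn_ord x); exists x'.
  by exists rep; split=> y; have [] := repP y.
apply: (@runs_for _ _ _ _ _ _ _ _ Inv (fun k => 5 * (n - k))) => //=.
move=> k st' kn [fr fm] ri I; exists 2; first by lia.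
apply: runs_step_seq => //=; apply: runs_step => //= x.
rewrite ltnS leq_eqVlt /= ri fm //= add0n.
have -> : mem st 3 k = Num (beta (Ordinal kn)) by rewrite -hb.
rewrite /= val_eqE => /orP[/eqP xk|/I[x' bx' mx']].
  have -> : x = Ordinal kn by apply: val_inj.
  by exists (Ordinal kn); rewrite ?eqxx.
by case: eqP => [->|_]; [exists (Ordinal kn)|exists x'].
Qed.

(** After the main loop register 8 equals the number of blocks and register 7 the number of output
    edges, so [Store 7 8 7] writes the last boundary. Register 14 counts the boundaries to be
    copied. *)
Definition quotient_program : program :=
  Const 2 1 ;; Const 5 0 ;; clear ;; represent ;;
  Const 7 0 ;; Const 8 0 ;; for_to 8 1 (node mp) ;; Store 7 8 7 ;;
  Add 14 1 2 ;; copy 7 0 14 ;; copy 8 1 7 ;; copy 9 2 7 ;; Move 0 1.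

Lemma runs_quotient st :
  reg st 0 = Num n -> reg st 1 = Num m -> blocks_at beta st -> graph_at l st ->
  runs quotient_program st ((40 * km + 100) * (n + \sum_(x < n) size (l x)).+1)
    (fun st' => exists (rep : 'I_m -> 'I_n) (chunks : seq (seq (A * 'I_m))),
      [/\ cancel rep beta, size chunks = m,
          forall y : 'I_m, merged beta merge (l (rep y)) (nth [::] chunks y),
          reg st' 0 = Num m
        & [/\ array_holds st' 0
                [seq Num (sumn (take k (shape chunks))) | k <- iota 0 m.+1],
              array_holds st' 1 [seq Lab p.1 | p <- flatten chunks]
            & array_holds st' 2 [seq Num (nat_of_ord p.2) | p <- flatten chunks]]]).
Proof.
move=> r0 r1 hb hg; set E := \sum_(x < n) size (l x).
(* Work per block is charged to the nodes, since [beta] is onto. *)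
have mn : m <= n.
  have /fin_all_exists[rep repP] := beta_surj.
  by rewrite -(card_ord m) -(card_ord n); apply: leq_card (can_inj repP).
have wr r : r < 16 -> r \notin [:: 3; 4; 6; 7; 9; 10; 11; 12; 13; 14] ->
    writes_reg (node mp) r = false.
  move=> r16; rewrite !inE /= => ne; rewrite writes_reg_shift //.
  by apply/negbTE; lia.
(* Costs in program order: clearing heads, choosing representatives, main loop, copying boundaries,
   labels and targets. The last two are bounded through the output size [2 * km.+1 * E]. *)
apply: (@runs_leq _ _ _ _ (4 * m + 3 + (5 * n + 3 +
  (14 * m + (16 * km + 57) * E + 2 + (5 * m.+1 + 3 +
    (5 * (2 * km.+1 * E) + 3 + (5 * (2 * km.+1 * E) + 3 + 1))).+2).+2)).+2);
  first by nia.
do 2![apply: runs_step_seq => //=].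
apply: runs_seq; first exact: runs_clear.
move=> st1 h4 [fr1 fm1]; apply: runs_seq.
  by apply: runs_represent; rewrite /blocks_at ?fr1 ?fm1.
move=> st2 [rep [repK h6]] [fr2 fm2].
do 2![apply: runs_step_seq => //=].
(* Split [E] over the blocks: each fibre contributes at least the edges of its representative. *)
have DE : \sum_(y < m) size (l (rep y)) <= E.
  rewrite /E (partition_big beta predT) //=; apply: leq_sum => y _.
  by rewrite (bigD1 (rep y)) ?repK //= leq_addr.
set s2 := set_reg _ 8 _.
apply: runs_seq.
  apply: (runs_leq (t := 14 * m + (16 * km + 57) *
    (\sum_(y < m) size (l (rep y))) + 2)); first by nia.
  have h4' (y : 'I_m) : mem s2 4 y = Num 0 by rewrite /= fm2.
  have hb' : blocks_at beta s2 by rewrite /blocks_at /= fm2 // fm1.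
  have hg' : graph_at l s2.
    by rewrite /graph_at /edges_at /= !fm2 // !fm1.
  by apply: (runs_nodes merge_time merge0 _ _ _ _ _ hb' hg' h4' h6);
    rewrite //= fr2 // fr1.
move=> st3 [r8 [chunks [sz out [w1 [o7 o8 o9] w3]]]] [fr3 fm3].
have r2 : reg st3 2 = Num 1 by rewrite fr3 ?writes_reg_for ?wr //= fr2 // fr1.
have r1' : reg st3 1 = Num m by rewrite fr3 ?writes_reg_for ?wr //= fr2 // fr1.
do 2![apply: runs_step_seq => //=].
set s3 := set_reg _ 14 _.
pose bd := [seq Num (sumn (take k (shape chunks))) | k <- iota 0 m.+1] : seq (value A).
have szb : size bd = m.+1 by rewrite size_map size_iota.
have szo : size (flatten chunks) <= 2 * km.+1 * E by nia.
apply: runs_seq.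
  apply: (@runs_leq _ _ _ _ (5 * size bd + 3)); first by rewrite szb.
  apply: runs_copy => //; first by rewrite szb /= r1' r2 /= addn1.
  have -> : bd = rcons (bounds A chunks) (Num (size (flatten chunks))).
    by rewrite -boundsS sz.
  apply: array_holds_rcons w3 _ => i _ /=.
  by rewrite r8 o7 /= /bounds size_map size_iota sz.
move=> st4 hb4 [fr4 fm4].
apply: runs_seq.
  apply: (@runs_leq _ _ _ _ (5 * size [seq @Lab A p.1 | p <- flatten chunks] + 3)).
    by rewrite size_map; lia.
  apply: runs_copy => //; rewrite ?fr4 //= ?size_map //.
  by rewrite /array_holds fm4.
move=> st5 hb5 [fr5 fm5].
apply: runs_seq.
  apply: (@runs_leq _ _ _ _
    (5 * size [seq @Num A (nat_of_ord p.2) | p <- flatten chunks] + 3)).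
    by rewrite size_map; lia.
  apply: runs_copy => //; rewrite ?fr5 ?fr4 //= ?size_map //.
  by rewrite /array_holds fm5 // fm4.
move=> st6 hb6 [fr6 fm6].
apply: runs_step => //.
exists rep, chunks; split=> //.
- by move=> y; apply: w1; rewrite sz.
- by rewrite /= fr6 // fr5 // fr4.
by split=> //; rewrite /array_holds /= fm6 // fm5.
Qed.

End QuotientProgram.

(** * From arrays to coalgebras *)

(** Cut the concatenation around the list of [x]: its offset [lo] is the total length of the lists
    before it. *)
Lemma graph_of_adjacency (A : Type) n (l : 'I_n -> seq (A * 'I_n)) (st : state A) :
  let lists := [seq l i | i <- enum 'I_n] in
  array_holds st 0 [seq Num (sumn (take k (shape lists))) | k <- iota 0 n.+1] ->
  array_holds st 1 [seq Lab p.1 | p <- flatten lists] ->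
  array_holds st 2 [seq Num (nat_of_ord p.2) | p <- flatten lists] ->
  graph_at l st.
Proof.
move=> lists h0 h1 h2 x.
have sz : size lists = n by rewrite size_map size_enum_ord.
have xs : x < size lists by rewrite sz.
have [es [dE tE nE]] := split_at xs.
have {nE} esE : es = l x.
  have := nE _ id [::]; rewrite map_id => <-.
  by rewrite (nth_map x) ?size_enum_ord // nth_ord_enum.
have B k : k <= n -> mem st 0 k = Num (sumn (take k (shape lists))).
  move=> kn; rewrite h0 ?size_map ?size_iota // (nth_map 0) ?size_iota //.
  by rewrite nth_iota.
pose lo := size (flatten (take x lists)).
have loE : lo = sumn (take x (shape lists)).
  by rewrite /lo size_flatten /shape map_take.
have fE : flatten lists = flatten (take x lists) ++ l x ++ flatten (drop x.+1 lists).
  by rewrite -{1}(cat_take_drop x lists) dE flatten_cat /= esE.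
exists lo; split.
- by rewrite B ?loE // ltnW.
- rewrite B // loE /shape -map_take tE map_rcons -cats1 sumn_cat /= addn0 esE.
  by rewrite map_take.
move=> k kx.
have N U (f : A * 'I_n -> U) u0 :
    nth u0 (map f (flatten lists)) (lo + k) = nth u0 (map f (l x)) k.
  rewrite fE !map_cat !nth_cat !size_map -/lo ltnNge leq_addr /= addKn.
  by rewrite kx.
have lt : lo + k < size (flatten lists) by rewrite fE !size_cat -/lo; lia.
by rewrite h1 ?h2 ?size_map // !N.
Qed.

Lemma bagmap_bag_of (X Y : Type) (f : X -> Y) (s : seq X) :
  bagmap f (bag_of s) = bag_of (map f s).
Proof.
apply: bag_ext => y; rewrite bagmapE bag_ofE count_map.
pose r : seq {classic X} := s.
pose P := fun x : {classic X} => `[< f x = y >].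
(* Multiplicities vanish outside [s], so the sum runs over the distinct members of [s] in the fibre,
   each weighted by its count. *)
rewrite (fsbigE (filter P (undup r))).
- rewrite big_filter_cond.
  transitivity (\sum_(x <- undup r | P x) iterop (count_mem x r) addn 1 0).
    apply: congr_big => // x; first by apply: andb_idr => /asboolP fx; rewrite mem_set.
    by rewrite Monoid.iteropE iter_addn_0 mul1n /bag_of mset_seqE.
  by rewrite big_undup_iterop_count sum1_count.
- by rewrite filter_uniq ?undup_uniq.
- by move=> x /=; rewrite mem_filter => /andP[/asboolP].
move=> x /= fx; rewrite mem_filter mem_undup /P (asboolT fx) /= => nin.
by rewrite /bag_of mset_seqE; apply/count_memPn.
Qed.

(** Injectivity of [rho] makes equality of targets in [Y] the same as equality of block numbers; the
    reversal in [labels_to] is invisible to bags. *)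
Lemma grouped_edgesE (F : set_functor) (A : Type)
    (flat : forall X : Type, F X -> bag (A * X)) (X Y : Type) (c : X -> F X)
    (q : X -> Y) n m (nu : 'I_n -> X) (rho : 'I_m -> Y) (beta : 'I_n -> 'I_m)
    (es : seq (A * 'I_n)) (x : X) (y : 'I_m) :
  injective rho -> (forall i, rho (beta i) = q (nu i)) ->
  bag_of [seq (p.1, nu p.2) | p <- es] = flat X (c x) ->
  grouped_edges flat c q x (rho y) = bag_of (labels_to beta es y).
Proof.
move=> rho_inj qE esE; apply: bag_ext => a.
rewrite /grouped_edges -esE bagmap_bag_of groupE !bag_ofE count_rev !count_map.
rewrite count_filter; apply: eq_count => p /=.
rewrite -qE; apply/asboolP/andP => [[-> /rho_inj ->]|[/asboolP -> /eqP ->]] //.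
by rewrite eqxx asboolT.
Qed.

Theorem theorem31 (F : set_functor) (A : Type)
    (flat : forall X : Type, F X -> bag (A * X))
    (merge : bag A -> bag A)
    (F1_nonempty : inhabited (F unit))
    (flat_encoding : is_encoding flat)
    (flat_uniform : uniform flat)
    (merge_interface : minimization_interface flat merge) :
  (forall (X : finType) (c : X -> F X) (Y : Type) (d : Y -> F Y) (q : X -> Y),
     coalg_morphism c d q -> (forall y, exists x, q x = y) ->
     (forall x a y',
        merged_edges flat merge c q x (a, y') =
        merge (grouped_edges flat c q x y') a) /\
     (forall s s' : Y -> X, cancel s q -> cancel s' q ->
        merged_edges flat merge c q \o s = merged_edges flat merge c q \o s') /\
     (forall s : Y -> X, cancel s q ->
        merged_edges flat merge c q \o s = flat Y \o d)) /\
  (forall ops : nat -> seq (value A) -> value A,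
     merge_linear_time ops merge ->
     exists (p : program) (k : nat),
       forall (X : finType) (c : X -> F X) (Y : Type) (d : Y -> F Y)
              (q : X -> Y) (s : Y -> X),
         coalg_morphism c d q -> (forall y, exists x, q x = y) ->
         cancel s q ->
       forall (n m : nat) (nu : 'I_n -> X) (rho : 'I_m -> Y) (st : state A),
         bijective nu -> bijective rho ->
         adjacency_at nu (fun x => flat X (c x)) st ->
         partition_at nu rho q st ->
         halts_within ops p st
           (k * (#|X| + \sum_(x : X) bag_size (flat X (c x))).+1)
           (adjacency_at rho (merged_edges flat merge c q \o s))).
Proof.
have mE (X Y : Type) c d q x := @merged_edgesE F A flat merge flat_uniform
  merge_interface X Y c d q x.
split=> [X c Y d q hq _|ops [mp [km merge_time]]].
  (* The right-hand side does not mention [s], so independence of the choice follows too. *)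
  have sE s : cancel s q -> merged_edges flat merge c q \o s = flat Y \o d.
    by move=> sK; apply: funext => y /=; rewrite (mE _ _ _ _ _ _ hq).2 sK.
  split=> [x a y|]; first by rewrite (mE _ _ _ _ _ _ hq).1.
  by split=> [s s' /sE -> /sE ->|].
exists (quotient_program mp), (40 * km + 100) => X c Y d q s hq q_surj sK.
move=> n m nu rho st nu_bij rho_bij [l [lE r0 h0 h1 h2]] [beta [betaE r1 h3]].
have rho_inj := bij_inj rho_bij.
have beta_surj y : exists x, beta x = y.
  have [x qx] := q_surj (rho y); have [nu' _ nuK] := nu_bij.
  by exists (nu' x); apply: rho_inj; rewrite betaE nuK.
have hb : blocks_at beta st.
  move=> x; rewrite h3; last by rewrite size_map size_enum_ord.
  by rewrite (nth_map x) ?size_enum_ord // nth_ord_enum.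
have merge0 : merge (bag_of [::]) = bag_of [::].
  have -> : bag_of [::] = empty_bag A.
    by apply: bag_ext => a; rewrite bag_ofE fsfunE.
  exact: merge_empty flat_uniform merge_interface F1_nonempty.
have -> : #|X| = n by rewrite -(bij_eq_card nu_bij) card_ord.
have -> : \sum_(x : X) bag_size (flat X (c x)) = \sum_(i < n) size (l i).
  rewrite (reindex nu (onW_bij _ nu_bij)); apply: eq_bigr => i _.
  by rewrite -lE -[seq_mset _]/(bag_of _) bag_size_bag_of size_map.
apply: runs_weaken (runs_quotient merge_time merge0 beta_surj r0 r1 hb
  (graph_of_adjacency h0 h1 h2)) => //.
move=> st' [rep [chunks [repK sz ch r0' [h0' h1' h2']]]] _.
have chE : [seq nth [::] chunks (nat_of_ord y) | y <- enum 'I_m] = chunks.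
  rewrite -[RHS](mkseq_nth [::]) sz /mkseq -val_enum_ord -map_comp.
  exact: eq_map.
exists (fun y => nth [::] chunks y); rewrite chE; split=> // y.
(* The program picks its own representatives, which may differ from [s]; both choices give the edges
   of [flat Y \o d] at [rho y]. *)
have -> : (merged_edges flat merge c q \o s) (rho y) =
          merged_edges flat merge c q (nu (rep y)).
  by rewrite /= !(mE _ _ _ _ _ _ hq).2 sK -betaE repK.
apply: bag_ext => -[a z']; have [rho' _ rhoK] := rho_bij.
rewrite -(rhoK z'); move: (rho' z') => z.
rewrite (mE _ _ _ _ _ _ hq).1 (grouped_edgesE z rho_inj betaE (lE (rep y))).
rewrite -ch -[seq_mset _]/(bag_of _) bag_ofE count_map; apply: eq_count => p /=.
apply/asboolP/asboolP => [[<- /rho_inj <-]|-> //].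
by case: p.
Qed.
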